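(* Let $A,B \in \mathbb{C}^{m \times n}$. Then the following statements are equivalent: (i) $A^\dagger+B^\dagger=A^\dagger(A+B)B^\dagger$; (ii) $R(B^* )\subseteq R(A^* )$ and $R(A)\subseteq R(B)$.
   Context: $R(X)$ denotes the range (column space) of a matrix $X$ and $X^*$ its conjugate transpose. $X^\dagger$ denotes the Moore-Penrose inverse of $X$, i.e. the unique matrix $Y$ with $XYX=X$, $YXY=Y$, $(XY)^*=XY$, $(YX)^*=YX$. *)

(* Defs.v *)
From mathcomp Require Import all_boot all_order all_algebra.
From mathcomp Require Import boolp classical_sets.

Set Implicit Arguments.
Unset Strict Implicit.
Unset Printing Implicit Defensive.

Import Order.TTheory GRing.Theory Num.Theory.
Local Open Scope ring_scope.
Local Open Scope classical_set_scope.
Local Open Scope sesquilinear_scope.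

Definition colspace (C : numClosedFieldType) (m n : nat) (X : 'M[C]_(m, n)) :
    set 'cV[C]_m :=
  range (fun v : 'cV[C]_n => X *m v).

Definition is_mpinv (C : numClosedFieldType) (m n : nat)
    (X : 'M[C]_(m, n)) (Y : 'M[C]_(n, m)) : bool :=
  [&& X *m Y *m X == X,
      Y *m X *m Y == Y,
      (X *m Y) ^t* == X *m Y
    & (Y *m X) ^t* == Y *m X].

Section MoorePenrose.
Variable C : numClosedFieldType.

Lemma trmxC_mul m n p (A : 'M[C]_(m, n)) (B : 'M[C]_(n, p)) :
  (A *m B) ^t* = B ^t* *m A ^t*.
Proof. by rewrite trmx_mul map_mxM. Qed.

Lemma row_free_gram_unit m n (G : 'M[C]_(m, n)) :
  row_free G -> G *m G ^t* \in unitmx.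
Proof.
move=> Gfree; rewrite -row_free_unit; apply/inj_row_free => v vGG0.
suff vG0 : v *m G = 0 by apply: (row_free_inj Gfree); rewrite mul0mx.
have : ((v *m G) *m (v *m G) ^t*) 0 0 = 0.
  by rewrite trmxC_mul !mulmxA -(mulmxA v) vGG0 !mul0mx mxE.
set w := v *m G; rewrite mxE => /eqP; rewrite psumr_eq0 => [/allP w0|j _].
  apply/rowP => j; rewrite [RHS]mxE; have := w0 j (mem_index_enum j).
  by rewrite /= !mxE mul_conjC_eq0 => /eqP.
by rewrite !mxE mul_conjC_ge0.
Qed.

(* For a full-rank factorisation F G, the inverse is
   G^* (G G^* )^-1 (F^* F)^-1 F^*. *)
Lemma mpinv_mul_exists m r n (F : 'M[C]_(m, r)) (G : 'M[C]_(r, n)) :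
  row_free (F ^t*) -> row_free G -> exists Y, is_mpinv (F *m G) Y.
Proof.
move=> Ffree Gfree; set X := F *m G.
pose U := G *m G ^t*; pose V := F ^t* *m F.
have Uu : U \in unitmx by apply: row_free_gram_unit.
have Vu : V \in unitmx by have := row_free_gram_unit Ffree; rewrite trmxCK.
have Uh : U ^t* = U by rewrite trmxC_mul trmxCK.
have Vh : V ^t* = V by rewrite trmxC_mul trmxCK.
have invh k (W : 'M[C]_k) : W ^t* = W -> (invmx W) ^t* = invmx W.
  by move=> Wh; rewrite trmx_inv map_invmx Wh.
exists (G ^t* *m invmx U *m invmx V *m F ^t*).
set Y := (Y in is_mpinv _ Y).
have XY : X *m Y = F *m invmx V *m F ^t*.
  by rewrite /X /Y !mulmxA -(mulmxA F G) -/U mulmxK.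
have YX : Y *m X = G ^t* *m invmx U *m G.
  by rewrite /X /Y !mulmxA -(mulmxA _ (F ^t*) F) -/V mulmxKV.
apply/and4P; split; apply/eqP.
- by rewrite XY /X !mulmxA -(mulmxA _ (F ^t*) F) -/V mulmxKV.
- by rewrite YX /Y !mulmxA -(mulmxA _ G) -/U mulmxKV.
- by rewrite XY !trmxC_mul trmxCK invh// !mulmxA.
- by rewrite YX !trmxC_mul trmxCK invh// !mulmxA.
Qed.

Lemma mpinv_exists m n (X : 'M[C]_(m, n)) : exists Y, is_mpinv X Y.
Proof.
rewrite -{1}(mulmx_base X); apply: mpinv_mul_exists (row_base_free X).
by rewrite /row_free mxrank_map mxrank_tr; exact: col_base_full.
Qed.

Definition mpinv m n (X : 'M[C]_(m, n)) : 'M[C]_(n, m) :=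
  xchoose (mpinv_exists X).

Lemma mpinvP m n (X : 'M[C]_(m, n)) : is_mpinv X (mpinv X).
Proof. exact: xchooseP. Qed.

Lemma is_mpinv_uniq m n (X : 'M[C]_(m, n)) (Y Z : 'M[C]_(n, m)) :
  is_mpinv X Y -> is_mpinv X Z -> Y = Z.
Proof.
case/and4P=> /eqP Y1 /eqP Y2 /eqP Y3 /eqP Y4.
case/and4P=> /eqP Z1 /eqP Z2 /eqP Z3 /eqP Z4.
have XYZ : X *m Y = X *m Z.
  by rewrite -Y3 -{1}Z1 -[X *m Z *m X *m Y]mulmxA trmxC_mul Y3 Z3 mulmxA Y1.
have YXZ : Y *m X = Z *m X.
  rewrite -Y4 -{1}Z1 !mulmxA -[Y *m X *m Z *m X]mulmxA trmxC_mul Y4 Z4.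
  by rewrite mulmxA -[Z *m X *m Y *m X]mulmxA -(mulmxA Z X) (mulmxA X) Y1.
by rewrite -Y2 -mulmxA XYZ mulmxA YXZ Z2.
Qed.

Lemma mpinv_unique m n (X : 'M[C]_(m, n)) (Y : 'M[C]_(n, m)) :
  is_mpinv X Y -> Y = mpinv X.
Proof. by move=> XY; exact: is_mpinv_uniq XY (mpinvP X). Qed.

End MoorePenrose.

(* Main.v *)
Require Import Defs.
From mathcomp Require Import all_boot all_order all_algebra.
From mathcomp Require Import complex.
From mathcomp Require Import classical_sets reals.

(** Put P := A^+ A and Q := B B^+, the orthogonal projections onto R(A^* ) and
    R(B). The right-hand side of (i) is P B^+ + A^+ Q. Since P A^+ = A^+,
    multiplying (i) by P on the left leaves A^+ = A^+ Q, and then B^+ = P B^+;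
    taking adjoints, these say P B^* = B^* and Q A = A, which is (ii). *)

Import GRing.Theory.
Local Open Scope ring_scope.
Local Open Scope classical_set_scope.
Local Open Scope sesquilinear_scope.

Section MoorePenroseRange.
Set Implicit Arguments.
Unset Strict Implicit.
Context {C : numClosedFieldType}.

(** [Y *m Z] is idempotent with range R(Y), so it fixes exactly the vectors of R(Y). It may be
    oblique: this covers [Z] = Y^+ as well as the adjoint setting. *)
Lemma colspace_subP m n p (X : 'M[C]_(m, n)) (Y : 'M[C]_(m, p))
    (Z : 'M[C]_(p, m)) :
  Y *m Z *m Y = Y -> colspace X `<=` colspace Y <-> Y *m Z *m X = X.
Proof.
move=> YZY; split=> [sXY | YZX _ [v _ <-]]; last first.
  by exists (Z *m X *m v) => //; rewrite !mulmxA YZX.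
apply/matrixP => i j.
have [v _ Yv] : colspace Y (col j X).
  by apply: sXY; exists (delta_mx j 0); rewrite // colE.
suff : (Y *m Z *m col j X) i 0 = (col j X) i 0
  by rewrite !colE mulmxA -!colE !mxE.
by rewrite -Yv mulmxA YZY.
Qed.

Section Projections.
Context {m n : nat}.
Implicit Type X : 'M[C]_(m, n).

Lemma mulmxKmpinv X : X *m mpinv X *m X = X.
Proof. by have /and4P[/eqP] := mpinvP X. Qed.

Lemma mpinvKmulmx X : mpinv X *m X *m mpinv X = mpinv X.
Proof. by have /and4P[_ /eqP] := mpinvP X. Qed.

Lemma mulmx_mpinv_adj X : (X *m mpinv X) ^t* = X *m mpinv X.
Proof. by have /and4P[_ _ /eqP] := mpinvP X. Qed.

Lemma mpinv_mulmx_adj X : (mpinv X *m X) ^t* = mpinv X *m X.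
Proof. by have /and4P[_ _ _ /eqP] := mpinvP X. Qed.

End Projections.

Lemma colspace_sub_mpinv m n p (X : 'M[C]_(m, n)) (Y : 'M[C]_(m, p)) :
  colspace X `<=` colspace Y <-> Y *m mpinv Y *m X = X.
Proof. exact/colspace_subP/mulmxKmpinv. Qed.

(** The adjoint of Y^+ is an inner inverse of Y^*, and its projection onto R(Y^* ) is Y^+ Y itself,
    since Y^+ Y is Hermitian. *)
Lemma colspace_adj_sub_mpinv m n p (X : 'M[C]_(n, m)) (Y : 'M[C]_(p, m)) :
  colspace (X ^t*) `<=` colspace (Y ^t*) <-> mpinv Y *m Y *m X ^t* = X ^t*.
Proof.
rewrite -mpinv_mulmx_adj trmxC_mul; apply: colspace_subP.
by rewrite -!trmxC_mul mulmxA mulmxKmpinv.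
Qed.

(** X^* and X^+ have the same range: each is a right multiple of the other, through X^+ X = X^*
    (X^+)^* and X^* = X^+ X X^*. *)
Lemma mulmx_adj_mpinv m n (S : 'M[C]_n) (X : 'M[C]_(m, n)) :
  S *m X ^t* = X ^t* <-> S *m mpinv X = mpinv X.
Proof.
split=> SX.
  have SP : S *m (mpinv X *m X) = mpinv X *m X.
    by rewrite -mpinv_mulmx_adj trmxC_mul mulmxA SX.
  by rewrite -{1}(mpinvKmulmx X) mulmxA SP mpinvKmulmx.
have XP : X ^t* = mpinv X *m X *m X ^t*.
  by rewrite -mpinv_mulmx_adj -trmxC_mul mulmxA mulmxKmpinv.
by rewrite XP !mulmxA SX.
Qed.

(** Both sides amount to [S] fixing the Hermitian projection X X^+, from the left or from the right;
    taking adjoints swaps the two. *)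
Lemma adj_mulmx_mpinv m n (S : 'M[C]_m) (X : 'M[C]_(m, n)) :
  S ^t* = S -> S *m X = X <-> mpinv X *m S = mpinv X.
Proof.
move=> Sh; split=> SX.
  have PS : X *m mpinv X *m S = X *m mpinv X.
    by rewrite -mulmx_mpinv_adj -{1}Sh -trmxC_mul mulmxA SX.
  by rewrite -{1}(mpinvKmulmx X) -!mulmxA (mulmxA X) PS mulmxA mpinvKmulmx.
have SP : S *m (X *m mpinv X) = X *m mpinv X.
  by rewrite -mulmx_mpinv_adj -{1}Sh -trmxC_mul -mulmxA SX.
by rewrite -{1}(mulmxKmpinv X) mulmxA SP mulmxKmpinv.
Qed.

Lemma mpinv_addP m n (A B : 'M[C]_(m, n)) :
  mpinv A + mpinv B = mpinv A *m (A + B) *m mpinv B <->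
  mpinv A *m A *m mpinv B = mpinv B /\ mpinv A *m (B *m mpinv B) = mpinv A.
Proof.
rewrite mulmxDr mulmxDl -(mulmxA _ B).
split=> [AB | [-> ->]]; last exact: addrC.
have AQ : mpinv A *m (B *m mpinv B) = mpinv A.
  (* P fixes A^+ and is idempotent, so P B^+ appears on both sides and cancels. *)
  have := congr1 (mulmx (mpinv A *m A)) AB.
  by rewrite !mulmxDr !mulmxA !mpinvKmulmx addrC => /addrI <-.
(* Once A^+ is added, writing it as A^+ Q on the left gives the right-hand side of (i). *)
split=> //; apply: (@addIr _ (mpinv A)).
by rewrite -{2}AQ -AB addrC.
Qed.

End MoorePenroseRange.

Theorem theorem4p1 (R : realType) (m n : nat) (A B : 'M[R[i]]_(m, n)) :
  mpinv A + mpinv B = mpinv A *m (A + B) *m mpinv B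
  <->
  colspace (B ^t*) `<=` colspace (A ^t*) /\ colspace A `<=` colspace B.
Proof.
rewrite mpinv_addP colspace_adj_sub_mpinv colspace_sub_mpinv mulmx_adj_mpinv.
by rewrite (adj_mulmx_mpinv _ (mulmx_mpinv_adj B)).
Qed.
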